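(* Let $p$ be an odd prime and let $\alpha,\beta,\gamma,\sigma$ be integers with $\alpha+\sigma\geq 2\gamma$, $\beta\geq\gamma\geq 1$ and $0\leq\sigma<\gamma$. Let $G$ be the group presented by \[ \left\langle a,b\ \middle|\ a^{p^{\alpha}}=b^{p^{\beta}}=[b,a]^{p^{\gamma}}=e,\ [a,b,a]=[a,b,b]=e,\ a^{p^{\alpha+\sigma-\gamma}}[b,a]^{p^{\sigma}}=e \right\rangle . \] Then $G$ is capable if and only if $\alpha=\beta$.
   Context: A group $G$ is capable if there exists a group $H$ with $G\cong H/Z(H)$, where $Z(H)$ is the center of $H$. Commutators are $[x,y]=x^{-1}y^{-1}xy$ and are left-normed: $[x,y,z]=[[x,y],z]$. *)

(* Defs.v *)
From HB Require Import structures.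
From mathcomp Require Import all_boot boolp.

Set Implicit Arguments.
Unset Strict Implicit.
Unset Printing Implicit Defensive.

Local Open Scope group_scope.
Local Open Scope quotient_scope.

(* Groups are the library's [groupType]s: arbitrary, possibly infinite groups.
   Its [~ x, y] is x^-1 * y^-1 * x * y and [~ x, y, z] is [~ [~ x, y], z]. *)

Definition in_center (H : groupType) (z : H) : Prop := forall x, commute z x.

Definition center_rel (H : groupType) (x y : H) : bool :=
  `[< in_center (x^-1 * y) >].

Lemma in_center1 (H : groupType) : in_center (1 : H).
Proof. by move=> x; rewrite /commute mul1g mulg1. Qed.

Lemma in_centerM (H : groupType) (y z : H) :
  in_center y -> in_center z -> in_center (y * z).
Proof. by move=> cy cz x; rewrite /commute -mulgA (cz x) mulgA (cy x) mulgA. Qed.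

Lemma in_centerV (H : groupType) (z : H) : in_center z -> in_center z^-1.
Proof.
move=> cz x; rewrite /commute; apply: (mulgI z).
by rewrite mulVKg mulgA (cz x) mulgK.
Qed.

Lemma in_centerJ (H : groupType) (z x : H) : in_center z -> x^-1 * (z * x) = z.
Proof. by move=> cz; rewrite (cz x) mulKg. Qed.

Lemma center_rel_refl (H : groupType) : reflexive (@center_rel H).
Proof. by move=> x; apply/asboolP; rewrite mulVg; apply: in_center1. Qed.

Lemma center_rel_sym (H : groupType) : symmetric (@center_rel H).
Proof.
move=> x y; rewrite /center_rel; apply: asbool_equiv_eq.
by split=> /in_centerV; rewrite invgM invgK.
Qed.

Lemma center_rel_trans (H : groupType) : transitive (@center_rel H).
Proof.
move=> y x z /asboolP cxy /asboolP cyz; apply/asboolP.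
by have := in_centerM cxy cyz; rewrite mulgA mulgK.
Qed.

Canonical center_equiv (H : groupType) :=
  EquivRel (@center_rel H)
    (@center_rel_refl H) (@center_rel_sym H) (@center_rel_trans H).

(* The quotient H / Z(H). *)
Definition central_quotient (H : groupType) : Type :=
  {eq_quot @center_equiv H}.

HB.instance Definition _ (H : groupType) :=
  Choice.on (central_quotient H).
HB.instance Definition _ (H : groupType) :=
  Quotient.on (central_quotient H).

Definition center_coset (H : groupType) (x : H) : central_quotient H :=
  \pi_(central_quotient H) x.

Definition cq_mul (H : groupType) (u v : central_quotient H) :=
  center_coset (repr u * repr v).
Definition cq_inv (H : groupType) (u : central_quotient H) :=
  center_coset (repr u)^-1.

Lemma center_cosetP (H : groupType) (x y : H) :
  center_coset x = center_coset y <-> in_center (x^-1 * y).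
Proof.
split=> [/eqmodP /asboolP //|cxy].
by apply/eqmodP/asboolP.
Qed.

Lemma center_coset_repr (H : groupType) (u : central_quotient H) :
  center_coset (repr u) = u.
Proof. exact: reprK. Qed.

Lemma cq_mulE (H : groupType) (x y : H) :
  cq_mul (center_coset x) (center_coset y) = center_coset (x * y).
Proof.
apply/center_cosetP.
set x' := repr _; set y' := repr _.
have /center_cosetP cx : center_coset x' = center_coset x.
  exact: center_coset_repr.
have /center_cosetP cy : center_coset y' = center_coset y.
  exact: center_coset_repr.
have -> : (x' * y')^-1 * (x * y) = y'^-1 * (x'^-1 * x * y') * (y'^-1 * y).
  by rewrite invgM !mulgA mulgK.
by rewrite (in_centerJ y' cx); apply: in_centerM.
Qed.

Lemma cq_invE (H : groupType) (x : H) :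
  cq_inv (center_coset x) = center_coset x^-1.
Proof.
apply/center_cosetP; set x' := repr _.
have /center_cosetP cx : center_coset x = center_coset x'.
  by rewrite center_coset_repr.
rewrite invgK; have -> : x' * x^-1 = x * (x^-1 * x') * x^-1.
  by rewrite mulVKg.
by rewrite -(cx x) mulgK.
Qed.

Lemma cq_mulA (H : groupType) : associative (@cq_mul H).
Proof.
move=> u v w; rewrite -(center_coset_repr u) -(center_coset_repr v).
by rewrite -(center_coset_repr w) !cq_mulE mulgA.
Qed.

Lemma cq_mul1 (H : groupType) : left_id (center_coset (1 : H)) (@cq_mul H).
Proof. by move=> u; rewrite -(center_coset_repr u) cq_mulE mul1g. Qed.

Lemma cq_mulr1 (H : groupType) : right_id (center_coset (1 : H)) (@cq_mul H).
Proof. by move=> u; rewrite -(center_coset_repr u) cq_mulE mulg1. Qed.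

Lemma cq_mulV (H : groupType) :
  left_inverse (center_coset (1 : H)) (@cq_inv H) (@cq_mul H).
Proof. by move=> u; rewrite -(center_coset_repr u) cq_invE cq_mulE mulVg. Qed.

Lemma cq_mulrV (H : groupType) :
  right_inverse (center_coset (1 : H)) (@cq_inv H) (@cq_mul H).
Proof. by move=> u; rewrite -(center_coset_repr u) cq_invE cq_mulE mulgV. Qed.

HB.instance Definition _ (H : groupType) :=
  isGroup.Build (central_quotient H) (@cq_mulA H) (@cq_mul1 H) (@cq_mulr1 H)
    (@cq_mulV H) (@cq_mulrV H).

Definition isomorphic (G K : groupType) : Prop :=
  exists f : {multiplicative G -> K}, bijective f.

Definition capable (G : groupType) : Prop :=
  exists H : groupType, isomorphic G (central_quotient H).

(* G is the group presented by two generators, mapped to a and b in G, subject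
   to the relations [rels], which are interpreted in every group: the standard
   universal property, which determines (G, a, b) up to a unique isomorphism. *)
Definition presented2 (rels : forall K : groupType, K -> K -> Prop)
    (G : groupType) (a b : G) : Prop :=
  rels G a b /\
  forall (K : groupType) (x y : K), rels K x y ->
    (exists f : {multiplicative G -> K}, f a = x /\ f b = y) /\
    (forall f g : {multiplicative G -> K},
       f a = x -> f b = y -> g a = x -> g b = y -> f =1 g).

Definition G_rels (p alpha beta gamma sigma : nat)
    (K : groupType) (a b : K) : Prop :=
  a ^+ (p ^ alpha)%N = 1 /\ b ^+ (p ^ beta)%N = 1 /\
  [~ b, a] ^+ (p ^ gamma)%N = 1 /\
  [~ a, b, a] = 1 /\ [~ a, b, b] = 1 /\
  a ^+ (p ^ (alpha + sigma - gamma))%N * [~ b, a] ^+ (p ^ sigma)%N = 1.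

(* Main.v *)
From HB Require Import structures.
Require Import Defs.
From mathcomp Require Import all_boot all_algebra perm boolp ring zify.

(** Put n = alpha + sigma - gamma, so that gamma <= n, and c = [b, a].

    Suppose G = H / Z(H), and lift a, b, c to x, y, c = [y, x] in H. Then
    u = [c, x] and v = [c, y] are central and killed by p^gamma. Since
    x^(p^n) c^(p^sigma) commutes with x and with y, we get u^(p^sigma) = 1 and
    c^(p^n) = v^(p^sigma), so that c^(p^alpha) = 1; since y^(p^beta) commutes
    with x, also c^(p^beta) = 1. If beta < alpha, then x^(p^(alpha-1)) commutes
    with y, hence is central, so a^(p^(alpha-1)) = 1; likewise alpha < beta
    forces b^(p^(beta-1)) = 1. Permutation models of the relations refute both.

    If alpha = beta, let y act on an abelian group <x, c, v> by a unipotent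
    automorphism sending x to c and c to v up to higher terms, where the
    relations between c and v are those satisfied by a and c in G. Then
    x^i c^k commutes with y exactly when a^i c^k = 1, and the central quotient
    of the semidirect product is G. Adjoining to the centre a root w of v makes
    <c, v> a direct sum of two cyclic groups, generated by d = c w and w, of
    orders p^n and p^alpha. *)

Set Implicit Arguments.
Unset Strict Implicit.
Unset Printing Implicit Defensive.

(** * Capable quotients of groups satisfying the relations *)

Section GroupMorphisms.
Local Open Scope group_scope.
Variables (G K : groupType) (f : G -> K).
Hypothesis fM : {morph f : x y / x * y}.

Lemma morph1 : f 1 = 1.
Proof. by apply: (@mulIg _ (f 1)); rewrite -fM !mul1g. Qed.

Lemma morphV : {morph f : x / x^-1}.
Proof.
by move=> x; apply: (@mulIg _ (f x)); rewrite -fM !mulVg morph1.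
Qed.

Lemma morphX n : {morph f : x / x ^+ n}.
Proof.
by move=> x; elim: n => [|n IHn]; rewrite ?morph1 // !expgS fM IHn.
Qed.

Lemma morphR : {morph f : x y / [~ x, y]}.
Proof. by move=> x y; rewrite /commg /conjg !fM !morphV. Qed.

End GroupMorphisms.

(** * Powers in commutators whose next commutator is central *)

Section Commutators.
Local Open Scope group_scope.
Variable H : groupType.
Implicit Types x y z c : H.

Lemma in_centerX z n : in_center z -> in_center (z ^+ n).
Proof. by move=> cz x; apply/commute_sym/commuteX/commute_sym/cz. Qed.

Lemma in_center1P z : center_coset z = 1 <-> in_center z.
Proof.
split=> [zE|cz].
  have /center_cosetP : center_coset 1 = center_coset z by rewrite zE.
  by rewrite invg1 mul1g.
by apply/esym/center_cosetP; rewrite invg1 mul1g.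
Qed.

Lemma expg_dvd_eq1 z d n : d %| n -> z ^+ d = 1 -> z ^+ n = 1.
Proof. by move=> /dvdnP[k ->] zd; rewrite mulnC expgnA zd expg1n. Qed.

Lemma commXg_center c x n :
  in_center [~ c, x] -> [~ c ^+ n, x] = [~ c, x] ^+ n.
Proof.
move=> cu; apply: (@mulgI _ (x * c ^+ n)); rewrite -commgC.
elim: n => [|n IHn]; first by rewrite mul1g !mulg1.
rewrite [in LHS]expgSr -mulgA (commgC c x) !mulgA IHn expgSr [in RHS]expgSr.
by rewrite -!mulgA (mulgA _ c) (in_centerX n cu c) !mulgA.
Qed.

(** Moving one more x past [c ^+ n] costs [u ^+ n]; these costs add up to the exponent C(n, 2). *)
Lemma commgX_center y x n : in_center [~ y, x, x] ->
  [~ y, x ^+ n] = [~ y, x] ^+ n * [~ y, x, x] ^+ 'C(n, 2).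
Proof.
set c := [~ y, x]; set u := [~ c, x] => cu.
apply: (@mulgI _ (x ^+ n * y)); rewrite -commgC.
elim: n => [|n IHn]; first by rewrite bin0n !gsimp.
have cx : c ^+ n * x = x * (c ^+ n * u ^+ n).
  by rewrite (commgC (c ^+ n)) commXg_center // mulgA.
rewrite expgSr mulgA IHn -!mulgA (in_centerX _ cu x).
rewrite (mulgA (c ^+ n)) cx binS bin1 addnC expgnDr expgS.
rewrite !mulgA -(mulgA _ y x) (commgC y x) -/c !mulgA.
by []. Qed.

End Commutators.

Lemma center_cosetM (H : groupType) :
  {morph @center_coset H : x y / (x * y)%g}.
Proof. by move=> x y; rewrite -cq_mulE. Qed.

(** Since p is odd, (p^n - 1)/2 is an integer, so p^n itself divides the binomial. This removes the
    correction term of [commgX_center] at powers of p. *)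
Lemma dvdn_bin2_pX p m n : odd p -> m <= n -> p ^ m %| 'C(p ^ n, 2).
Proof.
move=> p_odd le_mn; rewrite bin2odd ?oddX ?p_odd ?orbT //.
by rewrite dvdn_mulr // dvdn_exp2l.
Qed.

(** * Consequences of capability for the orders of a and b *)

Section Necessity.
Local Open Scope group_scope.
Variables (p alpha beta gamma sigma : nat).
Hypothesis p_odd : odd p.
Hypotheses (h_alpha : 2 * gamma <= alpha + sigma)
  (h_beta : gamma <= beta) (h_sigma : sigma < gamma).
Variables (G : groupType) (a b : G).
Hypothesis G_pres : presented2 (G_rels p alpha beta gamma sigma) a b.

Lemma G_rels1 (K : groupType) : G_rels p alpha beta gamma sigma (1 : K) 1.
Proof. by rewrite /G_rels !commg1 !expg1n mul1g. Qed.

(** Conjugation by g is an endomorphism of G fixing a and b, so the uniqueness clause makes it the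
    identity. *)
Lemma presented2_center g : commute g a -> commute g b -> in_center g.
Proof.
move=> ga gb x; have [Grel /(_ G a b Grel)[_ uniq]] := G_pres.
pose cj := isMultiplicative.Build G G (conjg^~ g) (fun x y => conjMg x y g).
pose cjM : {multiplicative G -> G} := HB.pack (conjg^~ g) cj.
have /= : cjM x = idfun x.
  by apply: (uniq cjM idfun) => //=; apply/eqP; rewrite conjg_fix;
    apply/commgP/commute_sym.
by move=> xg; rewrite /commute -{1}xg -conjgC.
Qed.

Section Lift.
Variables (H : groupType) (f : {multiplicative G -> central_quotient H}).
Hypothesis f_bij : bijective f.
Let x := repr (f a).
Let y := repr (f b).

(* The image of w is central in G, so that h |-> [w, h] induces a morphism from
   G to H; it kills a and b, hence is trivial by the uniqueness clause of the
   presentation. *)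
Lemma lift_center w g : center_coset w = f g ->
  commute w x -> commute w y -> in_center w.
Proof.
move=> wE wx wy; have [Grel uniqK] := G_pres.
have f_inj := bij_inj f_bij.
have fM : {morph f : g h / g * h} by exact: gmulfM.
have cg : in_center g.
  by apply: presented2_center; apply: f_inj;
    rewrite !gmulfM -wE -[f _]center_coset_repr -!center_cosetM;
    congr center_coset.
have cw h : in_center [~ w, h].
  have [finv _ fK] := f_bij; apply/in_center1P.
  rewrite morphR ?wE; last exact: center_cosetM.
  rewrite -[center_coset h]fK -(morphR fM).
  by have /commgP/eqP-> := cg (finv (center_coset h)); rewrite (morph1 fM).
have wM h k : [~ w, h * k] = [~ w, h] * [~ w, k].
  apply: (@mulgI _ (h * k * w)); rewrite -commgC.
  move: (cw h) (commgC w h) (commgC w k).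
  move: [~ w, h] [~ w, k] => r s cr wh wk.
  by rewrite mulgA wh -mulgA cr mulgA -(mulgA h) wk -!mulgA cr.
have wz h k : center_coset h = center_coset k -> [~ w, h] = [~ w, k].
  move=> /center_cosetP hk.
  have /commgP/eqP whk : commute w (h^-1 * k) by apply/commute_sym/hk.
  by rewrite -[k](mulVKg h) wM whk mulg1.
pose d g := [~ w, repr (f g)].
have dM : {morph d : g h / g * h}.
  move=> g1 g2; rewrite /d -wM; apply: wz.
  by rewrite center_cosetM !center_coset_repr gmulfM.
pose dmul := isMultiplicative.Build G H d dM.
pose dmor : {multiplicative G -> H} := HB.pack d dmul.
pose cmul := isMultiplicative.Build G H (fun=> 1) (fun _ _ => esym (mul1g 1)).
pose cmor : {multiplicative G -> H} := HB.pack (fun _ : G => 1 : H) cmul.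
have [_ uniq] := uniqK H 1 1 (G_rels1 H).
have dE : dmor =1 cmor.
  by apply: uniq => //=; apply/eqP/commgP.
have [finv _ fK] := f_bij => h; apply/commgP/eqP.
have <- : dmor (finv (center_coset h)) = [~ w, h].
  by apply: wz; rewrite center_coset_repr fK.
by rewrite dE.
Qed.

End Lift.

Lemma capable_generators : capable G ->
  (beta < alpha -> a ^+ (p ^ alpha.-1)%N = 1) /\
  (alpha < beta -> b ^+ (p ^ beta.-1)%N = 1).
Proof.
move=> [H [f f_bij]]; have f_inj := bij_inj f_bij.
pose x := repr (f a); pose y := repr (f b).
have cM := @center_cosetM H; have fM : {morph f : g h / g * h} by exact: gmulfM.
have fa : f a = center_coset x by rewrite center_coset_repr.
have fb : f b = center_coset y by rewrite center_coset_repr.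
(* Turns each relation of G into the centrality in H of the lifted word, and back. *)
have toG : forall w g, f g = center_coset w -> in_center w <-> g = 1.
  move=> w g fg; rewrite -in_center1P -fg; split=> [f1|->];
    last exact: (morph1 fM).
  by apply: f_inj; rewrite f1 (morph1 fM).
have [[aE [bE [cE [cba [cbb rel]]]]] _] := G_pres.
pose c := [~ y, x].
have fc : f [~ b, a] = center_coset c by rewrite (morphR fM) (morphR cM) fa fb.
have cab : [~ a, b] = [~ b, a]^-1 by rewrite invgR.
have ca : [~ b, a, a] = 1.
  apply/eqP/commgP; rewrite -invgR; apply/commute_sym/commuteV/commute_sym.
  exact/commgP/eqP.
have cb : [~ b, a, b] = 1.
  apply/eqP/commgP; rewrite -invgR; apply/commute_sym/commuteV/commute_sym.
  exact/commgP/eqP.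
have c_u : in_center [~ c, x].
  by apply/(toG _ [~ b, a, a]) => //; rewrite (morphR fM) (morphR cM) fc fa.
have c_v : in_center [~ c, y].
  by apply/(toG _ [~ b, a, b]) => //; rewrite (morphR fM) (morphR cM) fc fb.
(* Expanding [x, y^m] produces [x, y, y], the commutator of [c^-1] with y, so the bounds on [c, y]
   are also needed for it. *)
have c_v' : in_center [~ x, y, y].
  by apply/(toG _ [~ a, b, b]) => //; rewrite !(morphR fM) !(morphR cM) fa fb.
have c_c : in_center (c ^+ (p ^ gamma)%N).
  by apply/(toG _ ([~ b, a] ^+ (p ^ gamma)%N)) => //;
    rewrite (morphX fM) (morphX cM) fc.
have comm_eq1 (z w : H) : commute z w -> [~ z, w] = 1.
  by move=> zw; apply/eqP/commgP.
have v1 : [~ c, y] ^+ (p ^ gamma)%N = 1.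
  by rewrite -commXg_center //; apply: comm_eq1.
have v1' : [~ x, y, y] ^+ (p ^ gamma)%N = 1.
  rewrite -commXg_center //; apply: comm_eq1; rewrite -invgR expVgn.
  exact: in_centerV.
have bin_v' m : gamma <= m -> [~ x, y, y] ^+ 'C(p ^ m, 2) = 1.
  by move=> le_m; apply: expg_dvd_eq1 v1'; apply: dvdn_bin2_pX.
have c_xc : in_center
    (x ^+ (p ^ (alpha + sigma - gamma))%N * c ^+ (p ^ sigma)%N).
  apply/(toG _ (a ^+ _ * [~ b, a] ^+ _)); last exact: rel.
  by rewrite fM cM !(morphX fM) !(morphX cM) fa fc.
have n_ge : gamma <= alpha + sigma - gamma by lia.
(* The central element of [c_xc] and its factor [x ^+ _] both commute with x, hence so does
   [c ^+ (p ^ sigma)]. *)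
have u1 : [~ c, x] ^+ (p ^ sigma)%N = 1.
  rewrite -commXg_center //; apply: comm_eq1.
  apply: (@mulgI _ (x ^+ (p ^ (alpha + sigma - gamma))%N)).
  by rewrite mulgA c_xc !mulgA -expgS -expgSr.
have bin_u m : gamma <= m -> [~ c, x] ^+ 'C(p ^ m, 2) = 1.
  move=> le_m; apply: expg_dvd_eq1 u1; apply: dvdn_bin2_pX => //.
  exact: leq_trans (ltnW _) le_m.
(* Moving y across the central element of [c_xc] creates [c ^+ (p ^ n)] at the power of x and
   [v ^+ (p ^ sigma)] at the power of c; centrality equates the two. *)
have cv : c ^+ (p ^ (alpha + sigma - gamma))%N = [~ c, y] ^+ (p ^ sigma)%N.
  have yX : y * x ^+ (p ^ (alpha + sigma - gamma))%N =
            x ^+ (p ^ (alpha + sigma - gamma))%N * y *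
            c ^+ (p ^ (alpha + sigma - gamma))%N.
    by rewrite (commgC y) commgX_center // bin_u // mulg1.
  have Cy : c ^+ (p ^ sigma)%N * y =
            y * c ^+ (p ^ sigma)%N * [~ c, y] ^+ (p ^ sigma)%N.
    by rewrite (commgC _ y) commXg_center.
  have CC : commute (c ^+ (p ^ (alpha + sigma - gamma))%N) (c ^+ (p ^ sigma)%N).
    exact/commuteX2/commute_refl.
  move: (c_xc y) yX Cy CC; rewrite /commute.
  move: (x ^+ _) (c ^+ _) (c ^+ _) ([~ c, y] ^+ _) => X C K V zy yX Ky CK.
  move: zy; rewrite -mulgA Ky !mulgA yX -!mulgA => /mulgI/mulgI.
  by rewrite CK => /mulgI.
have c_alpha : c ^+ (p ^ alpha)%N = 1.
  have -> : alpha = alpha + sigma - gamma + (gamma - sigma) by lia.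
  rewrite expnD expgnA cv -expgnA -expnD subnKC ?v1 //; exact: ltnW.
have c_beta : c ^+ (p ^ beta)%N = 1.
  have : [~ x, y ^+ (p ^ beta)%N] = 1.
    suff cy : in_center (y ^+ (p ^ beta)%N) by apply/comm_eq1/commute_sym.
    apply/(toG _ (b ^+ (p ^ beta)%N)) => //.
    by rewrite (morphX fM) (morphX cM) fb.
  rewrite commgX_center // bin_v' // mulg1 -invgR expVgn => cV.
  by rewrite -[LHS]invgK cV invg1.
have dvd_pred k l : k < l -> p ^ k %| p ^ l.-1.
  by case: l => // l lt_kl; apply: dvdn_exp2l.
split=> lt_ab.
  apply/(toG (x ^+ (p ^ alpha.-1)%N)).
    by rewrite (morphX fM) (morphX cM) fa.
  apply: (lift_center f_bij (g := a ^+ (p ^ alpha.-1)%N)) => //.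
  - by rewrite (morphX fM) (morphX cM) fa.
  - exact/commute_sym/commuteX/commute_refl.
  apply/commute_sym/commgP; rewrite commgX_center // bin_u ?mulg1; last by lia.
  by rewrite (expg_dvd_eq1 (dvd_pred _ _ lt_ab)).
apply/(toG (y ^+ (p ^ beta.-1)%N)).
  by rewrite (morphX fM) (morphX cM) fb.
apply: (lift_center f_bij (g := b ^+ (p ^ beta.-1)%N)) => //.
- by rewrite (morphX fM) (morphX cM) fb.
- apply/commute_sym/commgP; rewrite commgX_center // bin_v' ?mulg1; last by lia.
  by rewrite -invgR expVgn (expg_dvd_eq1 (dvd_pred _ _ lt_ab)) ?invg1.
exact/commute_sym/commuteX/commute_refl.
Qed.

End Necessity.

(** Naming the commutator through ba = abc lets a model be checked without computing inverses. *)
Lemma G_relsI p alpha beta gamma sigma (K : groupType) (a b c : K) :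
  (b * a = a * b * c)%g -> commute c a -> commute c b ->
  (a ^+ (p ^ alpha)%N = 1)%g -> (b ^+ (p ^ beta)%N = 1)%g ->
  (c ^+ (p ^ gamma)%N = 1)%g ->
  (a ^+ (p ^ (alpha + sigma - gamma))%N * c ^+ (p ^ sigma)%N = 1)%g ->
  G_rels p alpha beta gamma sigma a b.
Proof.
move=> ba ca cb a1 b1 c1 rel.
have cE : [~ b, a]%g = c.
  by apply: (@mulgI _ (a * b)%g); rewrite -commgC.
have cab : [~ a, b]%g = (c^-1)%g by rewrite -invgR cE.
rewrite /G_rels cE cab; split=> //; split=> //; split=> //; split.
  by apply/eqP/commgP/commute_sym/commuteV/commute_sym.
split=> //; by apply/eqP/commgP/commute_sym/commuteV/commute_sym.
Qed.

(** * A group of class three *)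

Section Extension.
Import GRing.Theory.
Local Open Scope ring_scope.

(** R holds the exponents of x, w and y, and T those of d. In the instance below, [tw_pi] is a
    reduction and [tw_iota] a multiplication by q, linear over R through [tw_pi]. The half serves
    the quadratic term of an exponential. *)
Record twist := Twist {
  tw_R : comNzRingType;
  tw_T : comNzRingType;
  tw_pi : {rmorphism tw_R -> tw_T};
  tw_iota : tw_T -> tw_R;
  tw_half : tw_R;
  tw_iotaD : {morph tw_iota : s t / s + t};
  tw_iotaM : forall x s, tw_iota (tw_pi x * s) = x * tw_iota s;
  tw_halfE : tw_half + tw_half = 1
}.

Variable D : twist.
Notation R := (tw_R D).
Notation T := (tw_T D).
Notation pi := (@tw_pi D).
Notation iota := (@tw_iota D).
Notation e := (tw_half D).

Let q := iota 1.

Lemma iota_pi x : iota (pi x) = x * q.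
Proof. by rewrite -[pi x]mulr1 tw_iotaM. Qed.

Lemma iotaN s : iota (- s) = - iota s.
Proof. by rewrite -mulN1r -(rmorphN1 pi) tw_iotaM mulN1r. Qed.

Lemma iota0 : iota 0 = 0.
Proof. by rewrite -(rmorph0 pi) iota_pi mul0r. Qed.

(* With q = iota 1, the tuple (i, s, t, j) stands for x^i d^s w^t y^j, where
   conjugation by y^j acts on the abelian group <x, d, w>, written additively,
   as exp(j N) for the nilpotent N with N x = d - w, N d = q w and N w = 0.
   The term in j ^+ 2 is the quadratic term of this exponential. *)
Definition twgroup : Type := (R * T * R * R)%type.
HB.instance Definition _ := Choice.on twgroup.

Definition tw (i : R) (s : T) (t j : R) : twgroup := (i, s, t, j).

Definition twgroup_mul (u v : twgroup) : twgroup :=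
  let: (i, s, t, j) := u in let: (i', s', t', j') := v in
  tw (i + i') (s + s' + pi (i' * j))
      (t + t' - i' * j + j * iota s' + e * q * i' * j ^+ 2) (j + j').
Definition twgroup_one : twgroup := tw 0 0 0 0.
Definition twgroup_inv (u : twgroup) : twgroup :=
  let: (i, s, t, j) := u in
  tw (- i) (- s + pi (i * j))
      (- t - i * j + j * iota s - e * q * i * j ^+ 2) (- j).

Lemma twgroup_mulA : associative twgroup_mul.
Proof.
move=> [[[i s] t] j] [[[i1 s1] t1] j1] [[[i2 s2] t2] j2]; rewrite /= /tw.
rewrite !tw_iotaD iota_pi; congr (_, _, _, _); try ring.
have -> : j * (iota s1 + iota s2 + i2 * j1 * q) =
          j * (iota s1 + iota s2 + i2 * j1 * (e + e) * q).
  by rewrite tw_halfE; ring.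
by ring.
Qed.

Lemma twgroup_mul1 : left_id twgroup_one twgroup_mul.
Proof. by move=> [[[i s] t] j]; congr (_, _, _, _); ring. Qed.

Lemma twgroup_mulr1 : right_id twgroup_one twgroup_mul.
Proof.
by move=> [[[i s] t] j]; rewrite /= iota0; congr (_, _, _, _); ring.
Qed.

Lemma twgroup_mulV : left_inverse twgroup_one twgroup_inv twgroup_mul.
Proof.
by move=> [[[i s] t] j]; congr (_, _, _, _); ring.
Qed.

Lemma twgroup_mulrV : right_inverse twgroup_one twgroup_inv twgroup_mul.
Proof.
move=> [[[i s] t] j]; rewrite /= tw_iotaD iotaN iota_pi.
congr (_, _, _, _); try ring.
have -> : j * (- iota s + i * j * q) = j * (- iota s + i * j * (e + e) * q).
  by rewrite tw_halfE; ring.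
by ring.
Qed.

HB.instance Definition _ := isGroup.Build twgroup
  twgroup_mulA twgroup_mul1 twgroup_mulr1 twgroup_mulV twgroup_mulrV.

Lemma twM i s t j i' s' t' j' :
  (tw i s t j * tw i' s' t' j')%g =
  tw (i + i') (s + s' + pi (i' * j))
      (t + t' - i' * j + j * iota s' + e * q * i' * j ^+ 2) (j + j').
Proof. by []. Qed.

Lemma twXx k : (tw 1 0 0 0 ^+ k)%g = tw k%:R 0 0 0.
Proof.
elim: k => [|k IHk]; first by [].
by rewrite expgS IHk twM iota0 -natr1; congr (_, _, _, _); ring.
Qed.

Lemma twXy k : (tw 0 0 0 1 ^+ k)%g = tw 0 0 0 k%:R.
Proof.
elim: k => [|k IHk]; first by [].
by rewrite expgS IHk twM iota0 -natr1; congr (_, _, _, _); ring.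
Qed.

Lemma twXz t k : (tw 0 1 t 0 ^+ k)%g = tw 0 k%:R (t *+ k) 0.
Proof.
elim: k => [|k IHk]; first by [].
by rewrite expgS IHk twM -natr1 mulrS; congr (_, _, _, _); ring.
Qed.

(** This is c = d w^-1 up to a higher term: [- e * q] is the q/2 of the quadratic term less the q
    gained by moving y past d. *)
Lemma tw_commg : [~ tw 0 0 0 1, tw 1 0 0 0]%g = tw 0 1 (- 1 - e * q) 0.
Proof.
apply: (@mulgI _ (tw 1 0 0 0 * tw 0 0 0 1)%g).
rewrite -commgC !twM iota0 -/q; congr (_, _, _, _); try ring.
have -> : (0 + 1) * q = (e + e) * q by rewrite tw_halfE; ring.
by ring.
Qed.

Lemma tw_central i s t :
  pi i = 0 -> iota s = i -> in_center (tw i s t 0).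
Proof.
move=> pi0 is_i [[[i1 s1] t1] j1]; rewrite /commute -/(tw i1 s1 t1 j1) !twM.
have qi : i * q = 0 by rewrite -iota_pi pi0 iota0.
rewrite is_i [pi (i * j1)]rmorphM pi0; congr (_, _, _, _); try ring.
have -> : e * q * i * j1 ^+ 2 = e * (i * q) * j1 ^+ 2 by ring.
by rewrite qi; ring.
Qed.

(** Commuting with x tests j: the d-coordinate gives [pi j = 0], hence [j * q = 0], and the summand
    -w of N x then forces j = 0. Commuting with y gives [pi i = 0], and [iota s = i] up to
    [e * (i * q)], which vanishes likewise. *)
Lemma tw_center i s t j :
  in_center (tw i s t j) -> [/\ j = 0, pi i = 0 & iota s = i].
Proof.
move=> cz.
have eq0 (V : zmodType) (x y : V) : x = y -> x - y = 0.
  by move=> ->; exact: subrr.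
have := cz (tw 1 0 0 0); rewrite /commute !twM iota0 => -[_ /eq0 Es /eq0 Et _].
have pij : pi j = 0 by rewrite -[RHS]Es; ring.
have qj : j * q = 0 by rewrite -iota_pi pij iota0.
have j0 : j = 0.
  have -> : j = e * (j * q) * j - (t + 0 - 1 * j + j * 0 + e * q * 1 * j ^+ 2
     - (0 + t - i * 0 + 0 * iota s + e * q * i * 0 ^+ 2)) by ring.
  by rewrite Et qj; ring.
have := cz (tw 0 0 0 1); rewrite /commute !twM iota0 j0.
move=> -[_ /eq0 Es' /eq0 Et' _].
have pii : pi i = 0 by rewrite -[LHS]addr0 -[in LHS]Es'; ring.
have qi : i * q = 0 by rewrite -iota_pi pii iota0.
split=> //; rewrite -[LHS]addr0 -[in LHS]Et'.
by transitivity (i - e * (i * q)); [ring | rewrite qi; ring].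
Qed.

Lemma tw_coset i s t t' j :
  center_coset (tw i s t j) = center_coset (tw i s t' j).
Proof.
have -> : tw i s t' j = (tw i s t j * tw 0 0 (t' - t) 0)%g.
  by rewrite twM iota0; congr (_, _, _, _); ring.
apply/center_cosetP; rewrite mulKg; apply: tw_central; last exact: iota0.
exact: rmorph0.
Qed.

Lemma tw_commute_zx t : commute (tw 0 1 t 0) (tw 1 0 0 0).
Proof.
by rewrite /commute !twM iota0; congr (_, _, _, _); ring.
Qed.

(** In the group itself the two products differ by the central w^q; only their cosets agree. *)
Lemma tw_commute_zy t :
  center_coset (tw 0 1 t 0 * tw 0 0 0 1)%g =
  center_coset (tw 0 0 0 1 * tw 0 1 t 0)%g.
Proof.
rewrite !twM (tw_coset _ _ _ (t + iota 1)); congr center_coset.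
by congr (_, _, _, _); ring.
Qed.

Lemma tw_Xxz t m k : (tw 1 0 0 0 ^+ m * tw 0 1 t 0 ^+ k)%g =
  tw m%:R k%:R (t *+ k) 0.
Proof.
by rewrite twXx twXz twM; congr (_, _, _, _); ring.
Qed.

Lemma tw_Xxzy t m k l :
  (tw 1 0 0 0 ^+ m * tw 0 1 t 0 ^+ k * tw 0 0 0 1 ^+ l)%g =
  tw m%:R k%:R (t *+ k) l%:R.
Proof.
by rewrite tw_Xxz twXy twM iota0; congr (_, _, _, _); ring.
Qed.

End Extension.

(** * Exponents modulo N *)

Section Zmod.
Import GRing.Theory.
Local Open Scope ring_scope.
Variable N : nat.
Hypothesis N_gt1 : (1 < N)%N.

Lemma val_ZpD (x y : 'Z_N) : (x + y)%R = ((x + y) %% N)%N :> nat.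
Proof. by rewrite /= {3}Zp_cast. Qed.

Lemma val_ZpM (x y : 'Z_N) : (x * y)%R = ((x * y) %% N)%N :> nat.
Proof. by rewrite /= {3}Zp_cast. Qed.

Lemma Zp_natr_eq0 n : ((n%:R : 'Z_N) == 0) = (N %| n)%N.
Proof. by rewrite -val_eqE /= val_Zp_nat. Qed.

Section Mulrn.
Variables (V : zmodType) (v : V).
Hypothesis vN : v *+ N = 0.

Lemma mulrn_modn n : v *+ (n %% N)%N = v *+ n.
Proof. by rewrite {2}(divn_eq n N) mulrnDr mulnC mulrnA vN mul0rn add0r. Qed.

Lemma mulrn_ZpD : {morph (fun x : 'Z_N => v *+ x) : x y / x + y}.
Proof. by move=> x y; rewrite val_ZpD mulrn_modn mulrnDr. Qed.

Lemma mulrn_Zp_nat n : v *+ (n%:R : 'Z_N) = v *+ n.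
Proof. by rewrite val_Zp_nat // mulrn_modn. Qed.

End Mulrn.

Section Expg.
Variables (G : groupType) (g : G).
Hypothesis gN : (g ^+ N = 1)%g.

Lemma expg_modn n : (g ^+ (n %% N)%N = g ^+ n)%g.
Proof.
by rewrite {2}(divn_eq n N) expgnDr mulnC expgnA gN expg1n mul1g.
Qed.

Lemma expg_ZpD (x y : 'Z_N) : (g ^+ (x + y)%R = g ^+ x * g ^+ y)%g.
Proof. by rewrite val_ZpD expg_modn expgnDr. Qed.

Lemma expg_ZpM (x y : 'Z_N) : (g ^+ (x * y)%R = g ^+ (x * y)%N)%g.
Proof. by rewrite val_ZpM expg_modn. Qed.

Lemma expg_Zp_nat n : (g ^+ (n%:R : 'Z_N)%R = g ^+ n)%g.
Proof. by rewrite val_Zp_nat // expg_modn. Qed.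

End Expg.
End Zmod.

(** * The twist over Z/P and Z/M *)

Section ZmodTwist.
Import GRing.Theory.
Local Open Scope ring_scope.
Variables (P M q : nat).
Hypotheses (P_gt1 : (1 < P)%N) (P_odd : odd P) (M_gt1 : (1 < M)%N).
Hypotheses (dvd_MP : (M %| P)%N) (dvd_PqM : (P %| q * M)%N).

(** [Zpi] is reduction modulo M and [Ziota] is multiplication by q. Both are written on
    representatives; they are additive because M divides P and P divides qM. *)
Definition Zpi (x : 'Z_P) : 'Z_M := 1 *+ x.
Definition Ziota (s : 'Z_M) : 'Z_P := q%:R *+ s.

Let TP : (1 : 'Z_M) *+ P = 0.
Proof. by apply/eqP; rewrite Zp_natr_eq0. Qed.
Let RM : (q%:R : 'Z_P) *+ M = 0.
Proof. by apply/eqP; rewrite -mulrnA Zp_natr_eq0. Qed.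

Lemma Zpi_nmod : nmod_morphism Zpi.
Proof. by split=> //; apply: mulrn_ZpD. Qed.

Lemma Zpi_monoid : monoid_morphism Zpi.
Proof.
split=> [|x y]; first exact: (mulrn_Zp_nat P_gt1 TP 1).
by rewrite /Zpi val_ZpM // mulrn_modn // natrM.
Qed.

Definition Zpi_rmorphism : {rmorphism 'Z_P -> 'Z_M} :=
  HB.pack Zpi (GRing.isNmodMorphism.Build _ _ Zpi Zpi_nmod)
    (GRing.isMonoidMorphism.Build _ _ Zpi Zpi_monoid).

Lemma Ziota_nat k : Ziota k%:R = (q * k)%N%:R.
Proof. by rewrite /Ziota mulrn_Zp_nat // -mulrnA. Qed.

Lemma ZiotaD : {morph Ziota : s t / s + t}.
Proof. exact: mulrn_ZpD. Qed.

Lemma ZiotaM x s : Ziota (Zpi x * s) = x * Ziota s.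
Proof.
rewrite /Zpi -{1}[s]natr_Zp -natrM /Ziota mulrn_Zp_nat //.
by rewrite mulnC mulrnA -[LHS]mulr_natl natr_Zp.
Qed.

Lemma Zhalf_proof : (P.+1./2)%:R + (P.+1./2)%:R = 1 :> 'Z_P.
Proof.
have /eqP P0 : (P%:R : 'Z_P) == 0 by rewrite Zp_natr_eq0.
by rewrite -natrD addnn even_halfK /= ?P_odd // -natr1 P0 add0r.
Qed.

Definition Ztwist : twist :=
  @Twist 'Z_P 'Z_M Zpi_rmorphism Ziota _ ZiotaD ZiotaM Zhalf_proof.

End ZmodTwist.

(** * Capability when the two exponents agree *)

Section Sufficiency.
Local Open Scope group_scope.
Variables (p alpha gamma sigma : nat).
Hypotheses (p_prime : prime p) (p_odd : odd p).
Hypotheses (h_alpha : 2 * gamma <= alpha + sigma)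
  (h_gamma : 1 <= gamma) (h_sigma : sigma < gamma).
Variables (G : groupType) (a b : G).
Hypothesis G_pres : presented2 (G_rels p alpha alpha gamma sigma) a b.

Let n := alpha + sigma - gamma.
Let P := (p ^ alpha)%N.
Let M := (p ^ n)%N.
(** Chosen so that q p^gamma = P and q p^sigma = M: by the description of the centre, these make
    c^(p^gamma) and x^M c^(p^sigma) central. *)
Let q := (p ^ (alpha - gamma))%N.
Let p_gt1 : 1 < p := prime_gt1 p_prime.

Let P_gt1 : 1 < P. Proof. by rewrite -(expn0 p) ltn_exp2l //; lia. Qed.
Let M_gt1 : 1 < M. Proof. by rewrite -(expn0 p) ltn_exp2l // /n; lia. Qed.
Let P_odd : odd P. Proof. by rewrite oddX p_odd orbT. Qed.
Let MP : M %| P. Proof. by rewrite dvdn_exp2l // /n; lia. Qed.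
Let qM : (q * p ^ sigma = M)%N.
Proof. by rewrite -expnD; congr (p ^ _)%N; rewrite /n; lia. Qed.
Let qP : (q * p ^ gamma = P)%N.
Proof. by rewrite -expnD; congr (p ^ _)%N; lia. Qed.
Let PqM : P %| (q * M)%N.
Proof. by rewrite -expnD dvdn_exp2l // /n; lia. Qed.

Definition capable_twist : twist :=
  Ztwist P_gt1 P_odd M_gt1 MP PqM.
Let H := twgroup capable_twist.

Let C := [~ b, a].

(** The central w is forgotten and d goes to C, since d and c agree modulo powers of w. *)
Definition twgroup_to (u : H) : G :=
  let: (i, s, t, j) := u in
  a ^+ (i : 'Z_P) * C ^+ (s : 'Z_M) * b ^+ (j : 'Z_P).

Let rels : G_rels p alpha alpha gamma sigma a b := G_pres.1.
Let aP : a ^+ P = 1. Proof. by case: rels. Qed.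
Let bP : b ^+ P = 1. Proof. by case: rels => _ []. Qed.
Let C_gamma : C ^+ (p ^ gamma)%N = 1. Proof. by case: rels => _ [_ []]. Qed.
Let aC : a ^+ M * C ^+ (p ^ sigma)%N = 1.
Proof. by case: rels => _ [_ [_ [_ []]]]. Qed.

Let C_center : in_center C.
Proof.
case: rels => _ [_ [_ [Ca [Cb _]]]]; rewrite /C -invgR; apply: in_centerV.
by apply: (presented2_center G_pres); apply/commgP/eqP.
Qed.

Let CM : C ^+ M = 1.
Proof. by apply: expg_dvd_eq1 C_gamma; rewrite dvdn_exp2l // /n; lia. Qed.

Let CP : C ^+ P = 1.
Proof. exact: expg_dvd_eq1 MP CM. Qed.

Let baX i j : b ^+ j * a ^+ i = a ^+ i * b ^+ j * C ^+ (i * j)%N.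
Proof.
have bj : [~ b ^+ j, a] = C ^+ j by rewrite commXg_center.
have bj1 : [~ b ^+ j, a, a] = 1 by rewrite bj; apply/eqP/commgP/in_centerX.
rewrite (commgC (b ^+ j)) commgX_center bj1 ?bj ?expg1n ?mulg1 -?expgnA;
  rewrite 1?mulnC //.
exact: in_center1.
Qed.

(** The summand [pi (i' * j)] of the product law is the exponent of C in [baX]; as C is central and
    killed by M, exponents of C may be read in Z/M. *)
Lemma twgroup_toM : {morph twgroup_to : u v / u * v}.
Proof.
move=> [[[i s] t] j] [[[i' s'] t'] j'].
transitivity (a ^+ (i + i' : 'Z_P)%R *
  C ^+ (s + s' + Zpi M (i' * j : 'Z_P)%R : 'Z_M)%R *
  b ^+ (j + j' : 'Z_P)%R); first by [].
rewrite (expg_ZpD P_gt1 aP) (expg_ZpD P_gt1 bP).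
rewrite !(expg_ZpD M_gt1 CM) (expg_Zp_nat M_gt1 CM).
rewrite (expg_ZpM P_gt1 CP) /twgroup_to.
have := baX i' j; have := in_centerX s C_center.
have := in_centerX s' C_center; have := in_centerX (i' * j)%N C_center.
move: (C ^+ s) (C ^+ s') (C ^+ (i' * j)%N) => c1 c2 c3 cc3 cc2 cc1 ba.
rewrite !mulgA -(mulgA _ _ (a ^+ i')) ba !mulgA -(mulgA _ c1 (a ^+ _)) (cc1 _).
rewrite mulgA -(mulgA _ (b ^+ j) c3) -(cc3 (b ^+ j)) mulgA.
rewrite -(mulgA _ (b ^+ j) c2).
by rewrite -(cc2 (b ^+ j)) mulgA -(mulgA _ c2 c3) (cc2 c3) !mulgA.
Qed.

(** Here i = qs modulo P is divisible by M = q p^sigma, so s = k p^sigma, and the image is the k-th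
    power of the relator a^M C^(p^sigma). *)
Lemma twgroup_to_center u : in_center u -> twgroup_to u = 1.
Proof.
move: u => [[[i s] t] j] /tw_center[/= j0 pi0 is_i].
rewrite /twgroup_to j0 mulg1 -is_i /Ziota -GRing.mulrnA (expg_Zp_nat P_gt1 aP).
have dvd_Mi : M %| (i : 'Z_P).
  by rewrite -(Zp_natr_eq0 M_gt1); apply/eqP.
have /dvdnP[k sk] : (p ^ sigma)%N %| (s : 'Z_M).
  move: dvd_Mi; rewrite -is_i /Ziota -GRing.mulrnA val_Zp_nat ?P_gt1 //.
  have -> : (M %| (q * s) %% P)%N = (M %| q * s)%N.
    by rewrite /dvdn modn_dvdm ?MP.
  rewrite -{1}qM dvdn_pmul2l //.
  by rewrite expn_gt0 prime_gt0.
rewrite sk mulnA [(q * k)%N]mulnC -mulnA qM !(mulnC k) !expgnA.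
rewrite -expgMn ?aC ?expg1n //.
exact/commute_sym/in_centerX.
Qed.

(** The presentation gives f from G to H / Z(H), and [twgroup_to] induces g backwards. The
    uniqueness clause shows that g after f is the identity; f after g is computed on the normal
    form. *)
Lemma balanced_capable : capable G.
Proof.
pose x : H := tw (D := capable_twist) 1 0 0 0.
pose y : H := tw (D := capable_twist) 0 0 0 1.
pose z := [~ y, x].
have zE : z = tw _ _ _ _ := tw_commg capable_twist.
set t0 := (_ - _)%R in zE.
have cM := @center_cosetM H.
have PR0 : (P%:R = 0 :> 'Z_P)%R by apply/eqP; rewrite Zp_natr_eq0 // P_gt1.
have relsH : G_rels p alpha alpha gamma sigma (center_coset x) (center_coset y).
  apply: (G_relsI (c := center_coset z)).
  - by rewrite -cM (commgC y x) !cM.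
  - by rewrite zE /commute -!cM tw_commute_zx.
  - by rewrite zE /commute -!cM; exact: tw_commute_zy.
  - by rewrite -(morphX cM) twXx /= PR0; exact: (morph1 cM).
  - by rewrite -(morphX cM) twXy /= PR0; exact: (morph1 cM).
  - rewrite -(morphX cM) zE twXz; apply/in_center1P/tw_central.
      exact: GRing.rmorph0.
    by rewrite /= Ziota_nat ?M_gt1 ?PqM ?P_gt1 // qP PR0.
  - rewrite -!(morphX cM) -cM zE tw_Xxz; apply/in_center1P/tw_central.
      by rewrite GRing.rmorph_nat; apply/eqP; rewrite Zp_natr_eq0 ?M_gt1.
    by rewrite /= Ziota_nat ?M_gt1 ?PqM ?P_gt1 // qM.
have [[f [fa fb]] _] := G_pres.2 _ _ _ relsH.
have fM : {morph f : g h / g * h} by exact: gmulfM.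
have fC : f C = center_coset z by rewrite (morphR fM) fa fb (morphR cM).
pose g (u : central_quotient H) := twgroup_to (repr u).
have gE u : g (center_coset u) = twgroup_to u.
  rewrite /g; set v := repr _.
  have /center_cosetP/twgroup_to_center : center_coset u = center_coset v.
    by rewrite center_coset_repr.
  rewrite twgroup_toM => uv1.
  rewrite -[v](mulVKg u) twgroup_toM twgroup_toM uv1.
  by rewrite mulg1.
have gM : {morph g : u v / u * v}.
  move=> u v; rewrite -(center_coset_repr u) -(center_coset_repr v) -cM.
  by rewrite !gE twgroup_toM.
exists H, f; exists g.
  pose gf := isMultiplicative.Build G G (g \o f)
    (fun _ _ => etrans (congr1 g (fM _ _)) (gM _ _)).
  pose gfM : {multiplicative G -> G} := HB.pack (g \o f) gf.
  have [_ uniq] := G_pres.2 _ _ _ rels.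
  have : gfM =1 idfun.
    apply: (uniq gfM idfun) => //=; rewrite ?fa ?fb gE /=.
      by rewrite !mulg1.
    by rewrite !mul1g.
  exact.
move=> u; rewrite -[u]center_coset_repr gE; move: (repr u) => [[[i s] t] j].
rewrite /twgroup_to !fM !(morphX fM) fa fb fC -!(morphX cM).
rewrite -(cM (x ^+ i)) -(cM (x ^+ i * z ^+ s)).
(* The lift found has a w-coordinate of its own, which the central coset ignores. *)
by rewrite zE tw_Xxzy !natr_Zp; apply: tw_coset.
Qed.
End Sufficiency.

(** * Permutation models *)

HB.instance Definition _ (U V : finZmodType) := GRing.Zmodule.on (U * V)%type.

Section Translation.
Import GRing.Theory.
Local Open Scope ring_scope.
Variables (V : finZmodType).

Definition translation (v : V) : {perm V} := perm (addIr v).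

Lemma translationE v w : translation v w = w + v.
Proof. exact: permE. Qed.

Lemma translationX v k : (translation v ^+ k)%g = translation (v *+ k).
Proof.
elim: k => [|k IHk]; apply/permP => w.
  by rewrite expg0 perm1 translationE addr0.
by rewrite expgSr IHk permM !translationE mulrSr addrA.
Qed.

Lemma translation_eq1 v : (translation v = 1)%g <-> v = 0.
Proof.
split=> [/permP/(_ 0)|->]; first by rewrite translationE perm1 add0r.
by apply/permP => w; rewrite translationE perm1 addr0.
Qed.

Lemma translationM v w :
  (translation v * translation w)%g = translation (v + w).
Proof. by apply/permP => u; rewrite permM !translationE addrA. Qed.

End Translation.

(** Killing a leaves b of order p^beta, which will contradict the case alpha < beta. *)
Lemma cyclic_model p alpha beta gamma sigma : 1 < p ^ beta ->
  G_rels p alpha beta gamma sigma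
    (1%g : {perm 'Z_(p ^ beta)}) (translation (1 : 'Z_(p ^ beta))%R).
Proof.
move=> N_gt1; apply: (G_relsI (c := 1%g)); rewrite ?mulg1 ?mul1g ?expg1n //.
- by rewrite /commute mul1g mulg1.
- by rewrite translationX translation_eq1; apply/eqP; rewrite Zp_natr_eq0.
exact: mulg1.
Qed.

Lemma cyclic_model_order p beta :
  1 < p ^ beta -> ~~ (p ^ beta %| p ^ beta.-1) ->
  (translation (1 : 'Z_(p ^ beta))%R ^+ (p ^ beta.-1) <> 1)%g.
Proof.
move=> N_gt1 ndvd; rewrite translationX translation_eq1; apply/eqP.
by rewrite Zp_natr_eq0.
Qed.

Lemma pairMn (U V : finZmodType) (u : U) (v : V) k :
  ((u, v) *+ k = (u *+ k, v *+ k))%R.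
Proof. by elim: k => // k IHk; rewrite !GRing.mulrS IHk. Qed.

(** * A shear and a translation of Z/M x Z/P *)

Section NonabelianModel.
Import GRing.Theory.
Local Open Scope ring_scope.
Variables (P M q : nat).
Hypotheses (P_gt1 : (1 < P)%N) (M_gt1 : (1 < M)%N).
Hypotheses (dvd_PqM : (P %| q * M)%N).
Notation V := ('Z_M * 'Z_P)%type.

Fact shear_inj : injective (fun v : V => (v.1, v.2 - Ziota P q v.1)).
Proof.
move=> [s t] [s' t'] e; have es : s = s' := congr1 fst e.
have : t - Ziota P q s = t' - Ziota P q s' := congr1 snd e.
by rewrite es => /addIr->.
Qed.

Definition shear : {perm V} := perm shear_inj.

Lemma shearX k (s : 'Z_M) (t : 'Z_P) :
  (shear ^+ k)%g (s, t) = (s, t - Ziota P q s *+ k).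
Proof.
elim: k => [|k IHk]; first by rewrite expg0 perm1 subr0.
by rewrite expgSr permM IHk permE /= mulrSr opprD addrA.
Qed.

(** Products of permutations apply the left factor first. Translating before shearing subtracts q
    once too often, and the last translation restores it. *)
Lemma shear_translation :
  (shear * translation ((1, -1)%R : V))%g =
  (translation ((1, -1)%R : V) * shear * translation ((0, q%:R)%R : V))%g.
Proof.
apply/permP => -[s t]; rewrite !permM !permE /=; congr (_, _) => /=.
  by rewrite addr0.
have iota1 : Ziota P q (1 : 'Z_M) = q%:R.
  by have := Ziota_nat P_gt1 M_gt1 dvd_PqM 1; rewrite muln1.
by rewrite ZiotaD // iota1; ring.
Qed.

Lemma shear_commute (r : 'Z_P) :
  commute (translation ((0, r)%R : V)) shear.
Proof.
apply/permP => -[s t]; rewrite !permM !translationE !permE.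
rewrite -[RHS]/(s + 0, t - Ziota P q s + r) /= addr0; congr (_, _).
by ring.
Qed.

End NonabelianModel.

(** The translation vectors satisfy M (1, -1) + p^sigma (0, q) = (0, 0) because q p^sigma = M; the
    shear dies at p^beta because P divides q p^beta. *)
Lemma nonabelian_model p alpha beta gamma sigma :
  1 < p ^ alpha -> prime p ->
  2 * gamma <= alpha + sigma -> gamma <= beta -> sigma < gamma ->
  G_rels p alpha beta gamma sigma
    (translation
      ((1, -1)%R : 'Z_(p ^ (alpha + sigma - gamma)) * 'Z_(p ^ alpha)))
    (shear (p ^ alpha) (p ^ (alpha + sigma - gamma)) (p ^ (alpha - gamma))).
Proof.
move=> P_gt1 p_prime h_alpha h_beta h_sigma; have p_gt1 := prime_gt1 p_prime.
have M_gt1 : 1 < p ^ (alpha + sigma - gamma).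
  by rewrite -(expn0 p) ltn_exp2l //; lia.
have PqM : p ^ alpha %| p ^ (alpha - gamma) * p ^ (alpha + sigma - gamma).
  by rewrite -expnD dvdn_exp2l //; lia.
have R0 k : p ^ alpha %| k -> (k%:R = 0 :> 'Z_(p ^ alpha))%R.
  by move=> ?; apply/eqP; rewrite Zp_natr_eq0.
have T0 k : p ^ (alpha + sigma - gamma) %| k ->
    (k%:R = 0 :> 'Z_(p ^ (alpha + sigma - gamma)))%R.
  by move=> ?; apply/eqP; rewrite Zp_natr_eq0.
have qR0 k : gamma <= k -> p ^ alpha %| p ^ (alpha - gamma) * p ^ k.
  by move=> ?; rewrite -expnD dvdn_exp2l //; lia.
apply: (G_relsI (c := translation ((0, (p ^ (alpha - gamma))%:R)%R :
    'Z_(p ^ (alpha + sigma - gamma)) * 'Z_(p ^ alpha)))).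
- exact: shear_translation.
- by rewrite /commute !translationM GRing.addrC.
- exact: shear_commute.
- rewrite translationX translation_eq1 pairMn GRing.mulNrn.
  by rewrite T0 ?R0 ?GRing.oppr0 // dvdn_exp2l //; lia.
- have qbeta : ((p ^ (alpha - gamma))%:R *+ p ^ beta = 0 :> 'Z_(p ^ alpha))%R.
    by rewrite -GRing.mulrnA R0 ?qR0.
  apply/permP => -[s t]; rewrite shearX perm1 /Ziota -GRing.mulrnA mulnC.
  by rewrite GRing.mulrnA qbeta GRing.mul0rn GRing.subr0.
- by rewrite translationX translation_eq1 pairMn GRing.mul0rn -GRing.mulrnA;
    rewrite R0 ?qR0.
rewrite !translationX translationM translation_eq1 !pairMn GRing.mul0rn.
rewrite GRing.mulNrn -GRing.mulrnA -expnD.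
have -> : alpha - gamma + sigma = alpha + sigma - gamma by lia.
rewrite T0 // -[LHS]/(0 + 0, - _%:R + _%:R)%R.
by rewrite GRing.addr0 GRing.addNr.
Qed.

(** The second coordinate -1 has full order p^alpha, which will contradict the case beta < alpha. *)
Lemma nonabelian_model_order p alpha m :
  1 < p ^ alpha -> ~~ (p ^ alpha %| p ^ alpha.-1) ->
  (translation ((1, -1)%R : 'Z_m * 'Z_(p ^ alpha)) ^+ (p ^ alpha.-1) <> 1)%g.
Proof.
move=> P_gt1 ndvd; rewrite translationX translation_eq1 pairMn => /(congr1 snd).
rewrite /= GRing.mulNrn => /eqP; rewrite GRing.oppr_eq0 Zp_natr_eq0 //.
exact/negP.
Qed.

(** * Assembling both implications *)

Theorem theorem6p3 (p alpha beta gamma sigma : nat)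
    (p_prime : prime p) (p_odd : odd p)
    (h_alpha : 2 * gamma <= alpha + sigma)
    (h_beta : gamma <= beta) (h_gamma : 1 <= gamma) (h_sigma : sigma < gamma)
    (G : groupType) (a b : G)
    (G_pres : presented2 (G_rels p alpha beta gamma sigma) a b) :
  capable G <-> alpha = beta.
Proof.
split=> [cap|eq_ab]; last first.
  move: G_pres; rewrite -eq_ab => G_pres'.
  exact: balanced_capable p_prime p_odd h_alpha h_gamma h_sigma _ _ _ G_pres'.
have p_gt1 := prime_gt1 p_prime.
have pX_gt1 k : 0 < k -> 1 < p ^ k by move=> ?; rewrite -(expn0 p) ltn_exp2l.
have ndvd k : 0 < k -> ~~ (p ^ k %| p ^ k.-1).
  by case: k => // k _; rewrite dvdn_Pexp2l // ltnn.
have [a_eq1 b_eq1] :=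
  capable_generators p_odd h_alpha h_beta h_sigma G_pres cap.
have alpha_gt0 : 0 < alpha by lia.
have beta_gt0 : 0 < beta by lia.
(* In either strict case a generator would satisfy a relation that fails for its image in one of the
   models. *)
case: (ltngtP alpha beta) => // [/b_eq1 b1|/a_eq1 a1].
  have [[f [_ fb]] _] :=
    G_pres.2 _ _ _ (cyclic_model alpha gamma sigma (pX_gt1 beta beta_gt0)).
  case: (cyclic_model_order (pX_gt1 beta beta_gt0) (ndvd beta beta_gt0)).
  have fM : {morph f : g h / (g * h)%g} by exact: gmulfM.
  by rewrite -fb -(morphX fM) b1 (morph1 fM).
have [[f [fa _]] _] := G_pres.2 _ _ _
  (nonabelian_model (pX_gt1 alpha alpha_gt0) p_prime h_alpha h_beta h_sigma).
have fM : {morph f : g h / (g * h)%g} by exact: gmulfM.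
case: (nonabelian_model_order (m := p ^ (alpha + sigma - gamma))
  (pX_gt1 alpha alpha_gt0) (ndvd alpha alpha_gt0)).
by rewrite -fa -(morphX fM) a1 (morph1 fM).
Qed.
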